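(* For every $n \in \mathbb{N}$, there exists a $\Gamma_n$-symmetric $\vec y$-linear IPS refutation over $\mathbb{F}_2$ of the unsatisfiable equation system $\mathrm{CFI}(G_n, u_n, 1)$, which has size at most $O(2^{|E_n|})$, where $E_n = E(G_n)$.
   Context: Let $(G_n)_{n \in \mathbb{N}}$ be an arbitrary family of $3$-regular connected undirected graphs $G_n = (V_n, E_n)$, and let $u_n \in V_n$ be an arbitrary distinguished vertex. For a $3$-regular connected graph $G=(V,E)$, a vertex $u \in V$ and $a \in \{0,1\}$, the CFI equation system $\mathrm{CFI}(G,u,a)$ over $\mathbb{F}_2$ has variable set $X = \{x^e_i \mid e \in E, i \in \mathbb{F}_2\}$ and consists of: the equations $x^e_i + x^f_j + x^g_k = i+j+k \bmod 2$ for every $v \in V\setminus\{u\}$ with $\{e,f,g\} = E(v)$ and every $i,j,k \in \mathbb{F}_2$; the equations $x^e_i + x^f_j + x^g_k = i+j+k+a \bmod 2$ for the vertex $u$ with $\{e,f,g\}=E(u)$ and every $i,j,k\in\mathbb{F}_2$; the equations $x^e_0 + x^e_1 = 1$ for every $e \in E$; and the Boolean axioms $x^2 - x = 0$ for every variable $x \in X$. This system is satisfiable iff $a = 0$. The group $\Gamma_n$ is the subgroup of $(\mathbb{F}_2^{E_n}, \oplus)$ of all vectors $\pi$ with $\sum_{e \in E(v)} \pi_e = 0 \bmod 2$ for every vertex $v$; it acts on $X$ by $\pi(x^e_i) = x^e_{i+\pi_e}$ (addition in $\mathbb{F}_2$), and $\mathrm{CFI}(G_n,u_n,1)$ is $\Gamma_n$-invariant.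 An IPS refutation of a system $\mathcal{F} = \{f_1,\dots,f_m\} \subseteq \mathbb{F}[X]$ is an algebraic circuit over variables $X \uplus Y$, $Y = \{y_1,\dots,y_m\}$ (one variable per axiom), computing a polynomial $C(\vec x,\vec y)$ with $C(\vec x, \vec 0) = 0$ and $C(\vec x, \vec f) = 1$; it is $\vec y$-linear if $C(\vec x,\vec y) = \sum_i y_i g_i(\vec x)$. Given a group $\Gamma$ acting on $X$ with $\mathcal{F}$ $\Gamma$-invariant, $\Gamma$ acts on $Y$ by $\pi(y_i) = y_j$ where $\pi(f_i) = f_j$, and a $\Gamma$-symmetric IPS refutation is one whose circuit is $\Gamma$-symmetric, i.e. every $\pi \in \Gamma$ acting on the input gates extends to a label-preserving automorphism of the circuit. The size of a refutation is the number of gates of the circuit (counted as at least $|X|+|Y|$). *)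

(* Defs.v *)
From HB Require Import structures.
From mathcomp Require Import all_boot all_order all_algebra all_fingroup.
From mathcomp Require Import mpoly.

Set Implicit Arguments.
Unset Strict Implicit.
Unset Printing Implicit Defensive.

Import GRing.Theory.
Local Open Scope ring_scope.

(** * Finite simple graphs *)

Record sgraph := SGraph {
  vertex :> finType;
  adj : rel vertex;
  adj_sym : ssrbool.symmetric adj;
  adj_irrefl : irreflexive adj
}.

Definition edge_set (G : sgraph) : {set {set G}} :=
  [set [set p.1; p.2] | p in [pred p : G * G | adj p.1 p.2]].

Definition edge (G : sgraph) : finType := {e : {set G} | e \in edge_set G}.

Definition incident (G : sgraph) (v : G) (e : edge G) : bool := v \in val e.

Definition edges_at (G : sgraph) (v : G) : finType := {e : edge G | incident v e}.

Definition regular (d : nat) (G : sgraph) : Prop :=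
  forall v : G, #|[set w | adj v w]| = d.

Definition connected (G : sgraph) : Prop :=
  forall v w : G, connect (@adj G) v w.

(** * Polynomials over a finite type of variables

   [{mpoly F[n]}] has its variables indexed by ['I_n]; a finite type [V] of
   variables is identified with ['I_#|V|] through [enum_rank]. *)

Notation polyv F V := {mpoly F[#|{: V}|]}.

Definition pvar (F : fieldType) (V : finType) (x : V) : polyv F V :=
  'X_(enum_rank x).

Definition psubst (F : fieldType) (V W : finType) (h : V -> polyv F W)
    (p : polyv F V) : polyv F W :=
  p \mPo [tuple h (enum_val i) | i < #|{: V}|].

HB.instance Definition _ (F : fieldType) (V W : finType) (h : V -> polyv F W) :=
  GRing.RMorphism.copy (psubst h)
    (comp_mpoly [tuple h (enum_val i) | i < #|{: V}|]).

Lemma psubst_var (F : fieldType) (V W : finType) (h : V -> polyv F W) x :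
  psubst h (pvar F x) = h x.
Proof. by rewrite /psubst /pvar comp_mpolyXU -tnth_nth tnth_mktuple enum_rankK. Qed.

Lemma psubst_const (F : fieldType) (V W : finType) (h : V -> polyv F W) c :
  psubst h c%:MP = c%:MP.
Proof. exact: comp_mpolyC. Qed.

(** * Algebraic circuits

   Labelled directed acyclic graphs of unbounded fan-in.  The gates without
   incoming wires are exactly those labelled by a variable or a constant, and
   a variable labels at most one gate, so that a permutation of the variables
   acts on the variable gates. *)

Inductive glabel (F V : Type) : Type :=
  | GVar of V
  | GConst of F
  | GAdd
  | GMul.
Arguments GAdd {F V}.
Arguments GMul {F V}.

Definition is_input (F V : Type) (l : glabel F V) : bool :=
  match l with GVar _ | GConst _ => true | GAdd | GMul => false end.

Definition map_glabel (F V W : Type) (h : V -> W) (l : glabel F V) :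
    glabel F W :=
  match l with
  | GVar x => GVar F (h x)
  | GConst c => GConst W c
  | GAdd => GAdd
  | GMul => GMul
  end.

Record circuit (F : fieldType) (V : finType) := Circuit {
  gate :> finType;
  label : gate -> glabel F V;
  wire : rel gate;
  output : gate;
  wire_acyclic : forall g h, wire g h -> ~~ connect wire h g;
  input_gateP : forall g, is_input (label g) = [forall h, ~~ wire h g];
  var_gate_uniq : forall g h x,
    label g = GVar F x -> label h = GVar F x -> g = h
}.

(* The first argument bounds the recursion depth; by acyclicity the number of
   gates is a sufficient bound, see [gate_polyE]. *)
Fixpoint eval_gate (F : fieldType) (V : finType) (C : circuit F V)
    (k : nat) (g : C) : polyv F V :=
  if k is k'.+1 then
    match label g with
    | GVar x => pvar F x
    | GConst c => c%:MP
    | GAdd => \sum_(h | wire h g) eval_gate k' h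
    | GMul => \prod_(h | wire h g) eval_gate k' h
    end
  else 0.

Definition gate_poly (F : fieldType) (V : finType) (C : circuit F V) (g : C) :
    polyv F V :=
  eval_gate #|C| g.

Definition circuit_poly (F : fieldType) (V : finType) (C : circuit F V) :
    polyv F V :=
  gate_poly (output C).

Section GatePoly.
Variables (F : fieldType) (V : finType) (C : circuit F V).
Implicit Types g h : C.

Let below g := [set h | connect (@wire F V C) h g].

Let below_wire g h : wire h g -> (#|below h| < #|below g|)%N.
Proof.
move=> hg; apply/proper_card/properP; split.
  by apply/subsetP=> i; rewrite !inE => ih; apply: connect_trans ih (connect1 hg).
by exists g; rewrite !inE ?connect0 // wire_acyclic.
Qed.

Lemma eval_gate_stable k l g :
  (#|below g| <= k)%N -> (#|below g| <= l)%N -> eval_gate k g = eval_gate l g.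
Proof.
have pos i : (0 < #|below i|)%N by apply/card_gt0P; exists i; rewrite inE connect0.
elim: k l g => [|k IH] [|l] g gk gl; try by have := pos g; case: #|_| gk gl.
rewrite /=.
have E h : wire h g -> eval_gate k h = eval_gate l h.
  move=> /below_wire hg; apply: IH; rewrite -ltnS; exact: leq_trans hg _.
by case: (label g) => //; apply: eq_bigr => h /E.
Qed.

Lemma gate_polyE g :
  gate_poly g =
    match label g with
    | GVar x => pvar F x
    | GConst c => c%:MP
    | GAdd => \sum_(h | wire h g) gate_poly h
    | GMul => \prod_(h | wire h g) gate_poly h
    end.
Proof.
rewrite /gate_poly (@eval_gate_stable #|C| #|C|.+1) ?max_card //.
exact: leqW (max_card _).
Qed.

End GatePoly.

(** * The ideal proof system

   A system of axioms is a family [f] of polynomials over the variables [X],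
   indexed by a finite type [Y], which doubles as the set of the variables
   [y_i]. *)

Section IPS.
Variables (F : fieldType) (X Y : finType) (f : Y -> polyv F X).

Definition ips_refutation (C : circuit F (X + Y)%type) : Prop :=
  psubst (fun z => match z with inl x => pvar F x | inr _ => 0 end)
    (circuit_poly C) = 0
  /\ psubst (fun z => match z with inl x => pvar F x | inr i => f i end)
    (circuit_poly C) = 1.

Definition y_linear (C : circuit F (X + Y)%type) : Prop :=
  exists g : Y -> polyv F X,
    circuit_poly C =
      \sum_i pvar F (inr i : X + Y)
             * psubst (fun x => pvar F (inl x : X + Y)) (g i).

Definition ips_size (C : circuit F (X + Y)%type) : nat :=
  maxn #|C| (#|X| + #|Y|).

Definition rename_vars (s : X -> X) (p : polyv F X) : polyv F X :=
  psubst (fun x => pvar F (s x)) p.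

Variables (gT : finGroupType) (to : {action gT &-> X}).

Definition invariant_system (Gamma : {group gT}) : Prop :=
  forall a, a \in Gamma ->
  forall i, exists j, f j = rename_vars (to^~ a) (f i).

(* [t] is the action of [a] on [X + Y], with [a y_i = y_j] where
   [a f_i = f_j]; it is determined by [a] as soon as [f] is injective. *)
Definition induced_action (a : gT) (t : X + Y -> X + Y) : Prop :=
  (forall x, t (inl x) = inl (to x a))
  /\ (forall i, exists2 j, t (inr i) = inr j &
        f j = rename_vars (to^~ a) (f i)).

Definition extends_to_automorphism (C : circuit F (X + Y)%type)
    (t : X + Y -> X + Y) : Prop :=
  exists s : {perm C},
    [/\ forall g h, wire (s g) (s h) = wire g h,
        s (output C) = output C
      & forall g, label (s g) = map_glabel t (label g)].

Definition symmetric_circuit (Gamma : {group gT})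
    (C : circuit F (X + Y)%type) : Prop :=
  forall a, a \in Gamma ->
  exists2 t, induced_action a t & extends_to_automorphism C t.

End IPS.

(** * The CFI equation systems and their symmetry group *)

(* The pointwise group law; the group law of ['F_2] is its addition. *)
HB.instance Definition _ (T : finType) := Group.on {ffun T -> 'F_2}.

Lemma ffunF2_mulgE (T : finType) (p q : {ffun T -> 'F_2}) : (p * q)%g = p + q.
Proof. by []. Qed.

Section CFI.
Variable G : sgraph.

Definition cfi_var : finType := (edge G * 'F_2)%type.

(* The indices of the axioms: a vertex [v] with values for the three edges at
   [v]; an edge; a variable (Boolean axioms). *)
Definition cfi_index : finType :=
  ({v : G & {ffun edges_at v -> 'F_2}} + edge G + cfi_var)%type.

Definition cfi_x (e : edge G) (i : 'F_2) : polyv 'F_2 cfi_var :=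
  pvar 'F_2 ((e, i) : cfi_var).

Definition cfi_vertex_axiom (u : G) (a : 'F_2) (v : G)
    (s : {ffun edges_at v -> 'F_2}) : polyv 'F_2 cfi_var :=
  \sum_e cfi_x (val e) (s e) - (\sum_e s e + (if v == u then a else 0))%:MP.

Definition cfi (u : G) (a : 'F_2) (i : cfi_index) : polyv 'F_2 cfi_var :=
  match i with
  | inl (inl (existT v s)) => cfi_vertex_axiom u a s
  | inl (inr e) => cfi_x e 0 + cfi_x e 1 - 1
  | inr x => pvar 'F_2 x ^+ 2 - pvar 'F_2 x
  end.

Definition cfi_group_set : {set {ffun edge G -> 'F_2}} :=
  [set p : {ffun edge G -> 'F_2} |
     [forall v : G, \sum_(e | incident v e) p e == 0]].

Lemma cfi_group_setP : group_set cfi_group_set.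
Proof.
apply/group_setP; split.
  by rewrite inE; apply/forallP=> v; rewrite big1 // => e _; rewrite ffunE.
move=> p q; rewrite !inE => /forallP hp /forallP hq; apply/forallP=> v.
under eq_bigr do rewrite ffunE.
by rewrite big_split /= (eqP (hp v)) (eqP (hq v)) addr0.
Qed.
Canonical cfi_group := Group cfi_group_setP.

Definition cfi_act (x : cfi_var) (p : {ffun edge G -> 'F_2}) : cfi_var :=
  (x.1, x.2 + p x.1).

Lemma cfi_act1 : cfi_act^~ 1%g =1 id.
Proof. by case=> e i; rewrite /cfi_act /= ffunE addr0. Qed.

Lemma cfi_actM x : act_morph cfi_act x.
Proof. by move=> p q; rewrite /cfi_act /= ffunE addrA. Qed.

Canonical cfi_action := TotalAction cfi_act1 cfi_actM.

(* The facts that make the action on the variables [y_i] well defined: the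
   system is invariant under the group, and its axioms are pairwise distinct. *)

Lemma cfi_invariant u a : invariant_system (cfi u a) cfi_action cfi_group.
Proof.
move=> p; rewrite inE => /forallP hp; case=> [[[v s]|e]|[e i]].
- exists (inl (inl (existT _ v [ffun e => s e + p (val e)]))).
  rewrite /= /cfi_vertex_axiom /rename_vars rmorphB rmorph_sum /= psubst_const.
  congr (_ - _%:MP).
    by apply: eq_bigr => e _; rewrite ffunE psubst_var.
  congr (_ + _); under eq_bigr do rewrite ffunE.
  by rewrite big_split /= -(big_sub (incident v) p) (eqP (hp v)) addr0.
- exists (inl (inr e)).
  rewrite /= /rename_vars rmorphB rmorphD rmorph1 /= !psubst_var /= /cfi_act /=.
  congr (_ - _); have : p e = 0 \/ p e = 1.
    by case: (p e) => [[|[|//]]] H; [left|right]; apply: val_inj.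
  case=> ->; rewrite ?addr0 ?add0r // addrC; congr (_ + pvar _ (_, _)).
  exact: val_inj.
exists (inr (cfi_act (e, i) p)).
by rewrite /= /rename_vars rmorphB rmorphXn /= !psubst_var.
Qed.

Lemma pvar_lin (V : finType) (x y : V) :
  (pvar 'F_2 x)@_U_(enum_rank y) = (x == y)%:R.
Proof. by rewrite /pvar mcoeffXU (inj_eq enum_rank_inj). Qed.

Lemma pvar2_lin (V : finType) (x y : V) :
  (pvar 'F_2 x ^+ 2)@_U_(enum_rank y) = 0.
Proof.
rewrite /pvar mpolyXn mcoeffX; case: eqP => // /(congr1 mdeg).
by rewrite mdegMn !mdeg1.
Qed.

Let lin (p : polyv 'F_2 cfi_var) := [pred x : cfi_var | p@_U_(enum_rank x) != 0].

Let lin_vertex u a v (s : {ffun edges_at v -> 'F_2}) x :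
  reflect (exists e, x = (val e, s e)) (x \in lin (cfi_vertex_axiom u a s)).
Proof.
rewrite inE /cfi_vertex_axiom mcoeffB mcoeffC mnm1_eq0 mulr0 subr0 raddf_sum /=.
under eq_bigr do rewrite /cfi_x pvar_lin.
apply: (iffP idP) => [|[e ->]].
  case: (pickP (fun e => (val e, s e) == x)) => [e /eqP <- _|no]; first by exists e.
  by rewrite big1 ?eqxx // => e _; rewrite no.
rewrite (bigD1 e) //= eqxx big1 ?addr0 // => e' ne.
by rewrite xpair_eqE (inj_eq val_inj) (negPf ne).
Qed.

Let lin_edge e x :
  (x \in lin (cfi_x e 0 + cfi_x e 1 - 1)) = (x.1 == e).
Proof.
case: x => e' i; rewrite inE mcoeffB mcoeffD !pvar_lin mcoeff1 mnm1_eq0 subr0.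
rewrite !xpair_eqE [e == e']eq_sym; case: (e' =P e) => //= _.
have [->|->] // : i = 0 \/ i = 1.
by case: i => [[|[|//]]] H; [left|right]; apply: val_inj.
Qed.

Let lin_bool x y :
  (y \in lin (pvar 'F_2 x ^+ 2 - pvar 'F_2 x)) = (y == x).
Proof.
by rewrite inE mcoeffB pvar2_lin pvar_lin sub0r oppr_eq0 [x == y]eq_sym; case: (y =P x).
Qed.

Let two_edges (v : G) : regular 3 G ->
  exists e1 e2 : edges_at v, val e1 != val e2.
Proof.
move=> /(_ v) reg; have /card_gt1P[w1 [w2 []]] : (1 < #|[set w | adj v w]|)%N.
  by rewrite reg.
rewrite !inE => a1 a2 ne.
have mk w : adj v w -> {e : edges_at v | val (val e) = [set v; w]}.
  move=> vw; have eE : [set v; w] \in edge_set G by apply/imsetP; exists (v, w).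
  pose e : edge G := Sub [set v; w] eE.
  have iE : incident v e by rewrite /incident /= !inE eqxx.
  by exists (Sub e iE).
have [e1 E1] := mk _ a1; have [e2 E2] := mk _ a2.
exists e1, e2; apply: contra ne => /eqP e12.
have : w1 \in val (val e2) by rewrite -e12 E1 !inE eqxx orbT.
rewrite E2 !inE => /orP[/eqP w1v|//].
by rewrite w1v adj_irrefl in a1.
Qed.

Let edge_ends (e : edge G) v w :
  incident v e -> incident w e -> v != w -> val e = [set v; w].
Proof.
rewrite /incident; case: e => e /= /imsetP[[x y] _ ->] /=; rewrite !inE.
by do 2![case/orP=> /eqP->]; rewrite ?eqxx // => _; apply/setP=> z; rewrite !inE orbC.
Qed.

Lemma cfi_inj u a : regular 3 G -> injective (cfi u a).
Proof.
move=> reg i j ij.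
have E x : (x \in lin (cfi u a i)) = (x \in lin (cfi u a j)) by rewrite ij.
have lv v (s : {ffun edges_at v -> 'F_2}) e :
  (val e, s e) \in lin (cfi_vertex_axiom u a s) by apply/lin_vertex; exists e.
have spread v (s : {ffun edges_at v -> 'F_2}) e :
  ~ forall y, y \in lin (cfi_vertex_axiom u a s) -> y.1 = e.
  move=> H; have [e1 [e2 /negP]] := two_edges v reg; apply; apply/eqP.
  by rewrite [LHS](H _ (lv v s e1)) [RHS](H _ (lv v s e2)).
case: i j E {ij} => [[[v s]|e]|x] [[[v' s']|e']|x'] E; rewrite /= in E.
- have vv : v = v'.
    have [e1 [e2 ne]] := two_edges v reg; apply/eqP; apply: contraR ne => ne.
    have at_ (e : edges_at v) : incident v' (val e).
      have := lv v s e; rewrite E => /lin_vertex[e' /(congr1 fst) ee].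
      by have -> : val e = val e' := ee; apply: valP.
    rewrite -(inj_eq val_inj); apply/eqP.
    by rewrite !(@edge_ends _ v v') ?at_ // ?(valP e1) ?(valP e2).
  subst v'; congr (inl (inl (existT _ _ _))); apply/ffunP=> e.
  by have := lv v s e; rewrite E => /lin_vertex[e' [/val_inj <-]].
- by case: (spread v s e') => y; rewrite E lin_edge => /eqP.
- by case: (spread v s x'.1) => y; rewrite E lin_bool => /eqP->.
- by case: (spread v' s' e) => y; rewrite -E lin_edge => /eqP.
- by have := E (e, 0); rewrite !lin_edge /= eqxx => /esym/eqP->.
- have := E (e, 0); have := E (e, 1); rewrite !lin_edge !lin_bool /= eqxx.
  by move=> /esym/eqP <- /esym/eqP[].
- by case: (spread v' s' x.1) => y; rewrite -E lin_bool => /eqP->.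
- have := E (e', 0); have := E (e', 1); rewrite !lin_edge !lin_bool /= eqxx.
  by move=> /eqP <- /eqP[].
- by have := E x; rewrite !lin_bool eqxx => /esym/eqP->.
Qed.

End CFI.

(* Main.v *)
Require Import Defs.
From mathcomp Require Import all_boot all_order all_algebra all_fingroup.
From mathcomp Require Import mpoly zify.

(** For a labelling [s] of the edges by ['F_2], adding up the vertex axioms
   [(v, s|_E(v))] over all vertices gives [1], because every edge has two ends
   and the characteristic is [2].  The group permutes these refutations, but a
   plain sum over an orbit vanishes in characteristic [2]; instead they are
   weighted by the monomials [m_s = \prod_e x^e_{s e}], so that
     [\sum_s m_s * \sum_v y_(v, s|_E(v))]
   becomes [\sum_s m_s = \prod_e (x^e_0 + x^e_1)] once the axioms are
   substituted for the [y]'s.  The factors [a_e = x^e_0 + x^e_1] are fixed by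
   the group, so telescoping along any order of the edges,
     [\prod_e a_e - 1 = \sum_e (a_e - 1) * \prod_(e' < e) a_e'],
   symmetrically corrects this value to [1] using the edge axioms. *)

Set Implicit Arguments.
Unset Strict Implicit.
Unset Printing Implicit Defensive.

Import GRing.Theory.
Local Open Scope ring_scope.

(** * Ranked relations, telescoping products and characteristic 2 *)

Lemma acyclic_of_rank (T : finType) (r : rel T) (rk : T -> nat) :
  (forall g h, r g h -> (rk g < rk h)%N) ->
  forall g h, r g h -> ~~ connect r h g.
Proof.
move=> rkr g h /rkr gh; apply/negP=> /connectP[p pth lst].
have : (rk h <= rk (last h p))%N.
  elim: p h pth {gh lst} => //= k p IH h /andP[/rkr hk /IH].
  exact: leq_trans (ltnW hk).
by rewrite -lst leqNgt gh.
Qed.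

Lemma telescope_prod_ord (R : comNzRingType) n (a : 'I_n -> R) :
  \sum_(i < n) (a i - 1) * \prod_(j < n | (j < i)%N) a j = \prod_i a i - 1.
Proof.
elim: n a => [|n IH] a; first by rewrite !big_ord0 subrr.
rewrite !big_ord_recr /=.
have -> : \prod_(j < n.+1 | (j < n)%N) a j
          = \prod_(j < n) a (widen_ord (leqnSn n) j).
  rewrite big_mkcond big_ord_recr /= ltnn mulr1.
  by apply: eq_bigr => j _; rewrite /= ltn_ord.
(* For [i < n] the new last index fails the test [n < i], so these terms are those of the shorter
   family. *)
under eq_bigr => i _.
  rewrite big_mkcond big_ord_recr /= [(n < i)%N]ltnNge (ltnW (ltn_ord i)) mulr1.
  rewrite -big_mkcond /=; over.
rewrite (IH (fun i => a (widen_ord (leqnSn n) i))) mulrBl mul1r mulrC.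
by rewrite addrC addrA subrK.
Qed.

Lemma telescope_prod (R : comNzRingType) (I : finType) (a : I -> R) :
  \sum_i (a i - 1) * \prod_(j | (enum_rank j < enum_rank i)%N) a j
  = \prod_i a i - 1.
Proof.
rewrite (reindex (@enum_val I I)); last first.
  by exists enum_rank => i _; rewrite ?enum_valK ?enum_rankK.
rewrite [in RHS](reindex (@enum_val I I)); last first.
  by exists enum_rank => i _; rewrite ?enum_valK ?enum_rankK.
rewrite -telescope_prod_ord; apply: eq_bigr => i _; congr (_ * _).
rewrite (reindex (@enum_val I I)); last first.
  by exists enum_rank => j _; rewrite ?enum_valK ?enum_rankK.
by apply: eq_bigl => j; rewrite !enum_valK.
Qed.

Lemma addrr_F2 (x : 'F_2) : x + x = 0.
Proof. exact: addrr_pchar2 (pchar_Fp _) x. Qed.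

Lemma pchar2_mpolyF2 n : 2%N \in [pchar {mpoly 'F_2[n]}].
Proof. by rewrite pchar_lalg pchar_Fp. Qed.

(** Every summand carries a factor [y_i], so linearity already yields the first condition on a
    refutation. *)
Lemma y_linear_psubst0 (F : fieldType) (X Y : finType)
    (C : circuit F (X + Y)%type) :
  y_linear C ->
  psubst (fun z => match z with inl x => pvar F x | inr _ => 0 end)
    (circuit_poly C) = 0.
Proof.
case=> g ->; rewrite rmorph_sum big1 // => i _.
by rewrite rmorphM /= psubst_var mul0r.
Qed.

(** * Incidence counts in regular graphs *)

Section Degrees.
Variable G : sgraph.

Lemma card_edge_ends (e : edge G) : #|val e| = 2%N.
Proof.
case: e => e /= /imsetP[[x y] /=]; rewrite inE /= => xy ->.
rewrite cards2; by case: eqP xy => // ->; rewrite adj_irrefl.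
Qed.

(** The map from [w] to [{v, w}] is a bijection from neighbours to incident edges; it is injective
    because a neighbour differs from [v]. *)
Lemma card_edges_at (v : G) : #|{: edges_at v}| = #|[set w | adj v w]|.
Proof.
rewrite card_sig.
have -> : #|[pred e | incident v e]| = #|[set val e | e in incident v]|.
  by rewrite card_imset //; apply: val_inj.
rewrite -(@card_in_imset _ _ (fun w => [set v; w])); last first.
  move=> w w'; rewrite !inE => vw _ /setP/(_ w); rewrite !inE eqxx orbT.
  by case: eqP vw => [->|_ _ /esym/eqP]; rewrite ?adj_irrefl.
congr #|pred_of_set _|; apply/setP=> A; apply/imsetP/imsetP.
  case=> [[e eE]]; rewrite unfold_in /incident /= => ve ->.
  case/imsetP: eE ve => [[x y]]; rewrite inE /= => xy -> ; rewrite !inE.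
  case/orP=> /eqP ->; first by exists y; rewrite ?inE.
  by exists x; rewrite ?inE 1?adj_sym // setUC.
case=> w; rewrite inE => vw ->.
have eE : [set v; w] \in edge_set G by apply/imsetP; exists (v, w).
exists (Sub [set v; w] eE : edge G) => //.
by rewrite unfold_in /incident /= !inE eqxx.
Qed.

(** Double counting by the two ends of an edge. Over [nmodType] it serves both the handshake count
    and the cancellation in characteristic 2. *)
Lemma sum_incident (R : nmodType) (F : edge G -> R) :
  \sum_(v : G) \sum_(e | incident v e) F e = \sum_e F e *+ 2.
Proof.
rewrite (exchange_big_dep predT) //=; apply: eq_bigr => e _.
by rewrite sumr_const card_edge_ends.
Qed.

Lemma regular_handshake d : regular d G -> (#|G| * d = #|edge G| * 2)%N.
Proof.
move=> reg; have := sum_incident (fun=> 1%N).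
rewrite -[RHS]/(\sum_(e : edge G) 2)%N sum_nat_const => <-.
rewrite -sum_nat_const; apply: eq_bigr => v _.
by rewrite -(reg v) -card_edges_at card_sig -sum1_card.
Qed.

(** A vertex has [2 ^ 3] axioms; an edge has its own axiom and two Boolean ones. *)
Lemma card_cfi_index :
  regular 3 G -> #|{: cfi_index G}| = (#|G| * 8 + #|edge G| * 3)%N.
Proof.
move=> reg; rewrite !card_sum card_prod card_Fp // card_tagged sumnE big_map.
rewrite big_enum /=.
under eq_bigr => v _ do rewrite card_ffun card_edges_at reg card_Fp //.
by rewrite sum_nat_const; lia.
Qed.

End Degrees.

(** * The refuting circuit *)

Section Refutation.
Variables (G : sgraph) (u : G).

Local Notation X := (cfi_var G).
Local Notation Y := (cfi_index G).
Local Notation labelling := {ffun edge G -> 'F_2}.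

Definition restr (v : G) (s : labelling) : {ffun edges_at v -> 'F_2} :=
  [ffun e => s (val e)].

Definition y_vertex (v : G) (s : labelling) : Y :=
  inl (inl (existT _ v (restr v s))).

Definition y_edge (e : edge G) : Y := inl (inr e).

Lemma sum_vertex_axioms (s : labelling) : \sum_v cfi u 1 (y_vertex v s) = 1.
Proof.
(* Splitting variables and constant alike by edge makes the contribution of an edge the same at both
   ends; only the charge at [u] survives. *)
have E v : cfi u 1 (y_vertex v s) =
    \sum_(e | incident v e) (cfi_x e (s e) - (s e)%:MP) - (v == u)%:R%:MP.
  rewrite /= /cfi_vertex_axiom.
  rewrite (big_sub (incident v) (fun e => cfi_x e (s e) - (s e)%:MP)).
  rewrite sumrB -rmorph_sum /= mpolyCD opprD addrA.
  have -> : (if v == u then 1 else 0 : 'F_2) = (v == u)%:R by case: (v == u).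
  congr (_ - _%:MP - _); last by apply: eq_bigr => e _; rewrite ffunE.
  by apply: eq_bigr => e _; rewrite ffunE.
rewrite (eq_bigr _ (fun v _ => E v)) sumrB sum_incident big1; last first.
  by move=> e _; rewrite mulr2n addrr_pchar2 // pchar2_mpolyF2.
rewrite sub0r oppr_pchar2 ?pchar2_mpolyF2 // (bigD1 u) //= eqxx big1 ?addr0 //.
by move=> v /negPf ->.
Qed.

(* Inputs; for every labelling [s] the gates [\sum_v y_(v, s|_E(v))] and its
   product with [m_s]; for every edge the gates [a_e] and
   [y_e * \prod_(e' < e) a_e']; the output. *)
Definition ref_gate : finType :=
  ((X + Y) + (labelling + labelling) + (edge G + edge G) + unit)%type.

Definition g_in (z : X + Y) : ref_gate := inl (inl (inl z)).
Definition g_vsum (s : labelling) : ref_gate := inl (inl (inr (inl s))).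
Definition g_vprod (s : labelling) : ref_gate := inl (inl (inr (inr s))).
Definition g_esum (e : edge G) : ref_gate := inl (inr (inl e)).
Definition g_eprod (e : edge G) : ref_gate := inl (inr (inr e)).
Definition g_out : ref_gate := inr tt.

Definition ref_label (g : ref_gate) : glabel 'F_2 (X + Y)%type :=
  match g with
  | inl (inl (inl z)) => GVar _ z
  | inl (inl (inr (inl _))) => GAdd
  | inl (inl (inr (inr _))) => GMul
  | inl (inr (inl _)) => GAdd
  | inl (inr (inr _)) => GMul
  | inr _ => GAdd
  end.

Definition ref_wire (g h : ref_gate) : bool :=
  match g, h with
  | inl (inl (inl (inr (inl (inl (existT v r)))))), inl (inl (inr (inl s))) =>
      restr v s == r
  | inl (inl (inl (inl x))), inl (inl (inr (inr s))) => s x.1 == x.2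
  | inl (inl (inr (inl s'))), inl (inl (inr (inr s))) => s' == s
  | inl (inl (inl (inl x))), inl (inr (inl e)) => x.1 == e
  | inl (inl (inl (inr (inl (inr e'))))), inl (inr (inr e)) => e' == e
  | inl (inr (inl e')), inl (inr (inr e)) => (enum_rank e' < enum_rank e)%N
  | inl (inl (inr (inr _))), inr _ => true
  | inl (inr (inr _)), inr _ => true
  | _, _ => false
  end.

Definition ref_rank (g : ref_gate) : nat :=
  match g with
  | inl (inl (inl _)) => 0
  | inl (inl (inr (inl _))) => 1
  | inl (inl (inr (inr _))) => 2
  | inl (inr (inl _)) => 1
  | inl (inr (inr _)) => 2
  | inr _ => 3
  end.

Lemma ref_wire_acyclic g h : ref_wire g h -> ~~ connect ref_wire h g.
Proof.
apply: (@acyclic_of_rank _ _ ref_rank) => {}g {}h.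
by move: g h => [[[[?|[[[? ?]|?]|?]]|[?|?]]|[?|?]]|?]
  [[[[?|[[[? ?]|?]|?]]|[?|?]]|[?|?]]|?].
Qed.

Lemma ref_input_gateP g :
  is_input (ref_label g) = [forall h, ~~ ref_wire h g].
Proof.
have some h : ref_wire h g -> [forall h, ~~ ref_wire h g] = false.
  by move=> hg; apply/negbTE/forallPn; exists h; rewrite negbK.
move: g some => [[[z|[s|s]]|[e|e]]|[]] some /=.
- apply/esym/forallP=> h.
  by case: h => [[[[?|[[[? ?]|?]|?]]|[?|?]]|[?|?]]|?].
- by rewrite (some (g_in (inr (y_vertex u s)))) /=.
- by rewrite (some (g_vsum s)) /=.
- by rewrite (some (g_in (inl (e, 0)))) /=.
- by rewrite (some (g_in (inr (y_edge e)))) /=.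
(* The zero labelling exists for any edge set. *)
- by rewrite (some (g_vprod 0)).
Qed.

Lemma ref_var_gate_uniq g h x :
  ref_label g = GVar 'F_2 x -> ref_label h = GVar 'F_2 x -> g = h.
Proof.
by move: g h => [[[?|[?|?]]|[?|?]]|?] [[[?|[?|?]]|[?|?]]|?] //= [->] [->].
Qed.

Definition ref_circuit : circuit 'F_2 (X + Y)%type :=
  Circuit g_out ref_wire_acyclic ref_input_gateP ref_var_gate_uniq.

(** * Polynomials computed at the gates *)

Local Notation x_ e i := (pvar 'F_2 (inl (e, i) : X + Y)).
Local Notation y_ i := (pvar 'F_2 (inr i : X + Y)).

Lemma gate_poly_in z :
  @gate_poly _ _ ref_circuit (g_in z) = pvar 'F_2 z.
Proof. by rewrite gate_polyE. Qed.

Lemma gate_poly_vsum s :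
  @gate_poly _ _ ref_circuit (g_vsum s) = \sum_v y_ (y_vertex v s).
Proof.
rewrite gate_polyE /= !big_sumType /= !big_pred0_eq !(add0r, addr0).
(* Each vertex contributes exactly one operand, the axiom whose local values agree with [s]. *)
rewrite (reindex_onto (fun v => existT _ v (restr v s)) tag) /=; last first.
  by case=> v r /eqP ->.
by apply: eq_big => v; rewrite ?eqxx // => _; apply: gate_poly_in.
Qed.

Lemma gate_poly_vprod s :
  @gate_poly _ _ ref_circuit (g_vprod s) =
  (\prod_e x_ e (s e)) * \sum_v y_ (y_vertex v s).
Proof.
rewrite gate_polyE /= !big_sumType /= !big_pred0_eq big_pred1_eq.
rewrite gate_poly_vsum [X in _ * (X * 1 * 1)]big_pred0; last by case.
rewrite !mulr1; congr (_ * _).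
rewrite (reindex_onto (fun e => (e, s e)) fst) /=; last first.
  by case=> e i /= /eqP ->.
by apply: eq_big => e; rewrite ?eqxx // => _; apply: gate_poly_in.
Qed.

Lemma gate_poly_esum e :
  @gate_poly _ _ ref_circuit (g_esum e) = x_ e 0 + x_ e 1.
Proof.
rewrite gate_polyE /= !big_sumType /= !big_pred0_eq.
rewrite [X in _ + (X + 0 + 0)]big_pred0; last by case.
rewrite !addr0 (reindex_onto (pair e) snd) /=; last first.
  by case=> e' i /= /eqP ->.
rewrite (eq_bigl xpredT); last by move=> i; rewrite !eqxx.
rewrite !big_ord_recl big_ord0 addr0 !gate_poly_in.
congr (_ + pvar _ (inl (_, _))); exact: val_inj.
Qed.

Lemma gate_poly_eprod e :
  @gate_poly _ _ ref_circuit (g_eprod e) = y_ (y_edge e) *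
  \prod_(e' | (enum_rank e' < enum_rank e)%N) (x_ e' 0 + x_ e' 1).
Proof.
rewrite gate_polyE /= !big_sumType /= !big_pred0_eq.
rewrite [X in _ * (X * _ * 1)]big_pred0; last by case.
rewrite big_pred1_eq gate_poly_in !(mul1r, mulr1); congr (_ * _).
by apply: eq_bigr => e' _; apply: gate_poly_esum.
Qed.

Lemma ref_circuit_poly :
  circuit_poly ref_circuit =
  \sum_(s : labelling) (\prod_e x_ e (s e)) * (\sum_v y_ (y_vertex v s)) +
  \sum_e y_ (y_edge e) *
    \prod_(e' | (enum_rank e' < enum_rank e)%N) (x_ e' 0 + x_ e' 1).
Proof.
rewrite /circuit_poly gate_polyE /= !big_sumType /= !big_pred0_eq.
rewrite [X in _ + (X + 0 + 0)]big_pred0; last by case.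
rewrite !(add0r, addr0); congr (_ + _); apply: eq_bigr => i _.
  exact: gate_poly_vprod.
exact: gate_poly_eprod.
Qed.

Lemma ref_circuit_y_linear : y_linear ref_circuit.
Proof.
pose m (s : labelling) := \prod_e cfi_x e (s e).
(* The coefficient of [y_(v, r)] collects the monomials of all labellings extending [r]. *)
pose g (i : Y) := match i with
  | inl (inl (existT v r)) => \sum_(s | restr v s == r) m s
  | inl (inr e) =>
      \prod_(e' | (enum_rank e' < enum_rank e)%N) (cfi_x e' 0 + cfi_x e' 1)
  | inr _ => 0
  end.
exists g; rewrite ref_circuit_poly !big_sumType /=.
rewrite [X in _ = _ + X]big1 ?addr0; last by move=> x _; rewrite rmorph0 mulr0.
congr (_ + _); last first.
  apply: eq_bigr => e _; congr (_ * _); rewrite rmorph_prod /=.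
  by apply: eq_bigr => e' _; rewrite rmorphD /= !psubst_var.
have mE s : psubst (fun x => pvar 'F_2 (inl x : X + Y)) (m s) =
            \prod_e x_ e (s e).
  by rewrite rmorph_prod /=; apply: eq_bigr => e _; rewrite psubst_var.
under eq_bigr => s _ do rewrite -mE mulr_sumr.
rewrite exchange_big /=.
(* At each [v], the labellings are grouped by their restriction to the edges at [v]. *)
transitivity (\sum_v \sum_(r : {ffun edges_at v -> 'F_2})
  y_ (inl (inl (existT _ v r))) *
  psubst (fun x => pvar 'F_2 (inl x : X + Y)) (\sum_(s | restr v s == r) m s)).
  apply: eq_bigr => v _; rewrite (partition_big (restr v) predT) //=.
  apply: eq_bigr => r _; rewrite rmorph_sum mulr_sumr /=.
  by apply: eq_bigr => s /eqP <-; rewrite mulrC.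
by rewrite sig_big_dep; apply: eq_bigr => [[v r]] _.
Qed.

Lemma ref_circuit_refutation : ips_refutation (cfi u 1) ref_circuit.
Proof.
split; first exact: y_linear_psubst0 ref_circuit_y_linear.
pose a (e : edge G) := cfi_x e 0 + cfi_x e 1.
rewrite ref_circuit_poly rmorphD !rmorph_sum /=.
have V (s : labelling) : psubst (fun z => match z with inl x => pvar 'F_2 x
                          | inr i => cfi u 1 i end)
    ((\prod_e x_ e (s e)) * \sum_v y_ (y_vertex v s)) = \prod_e cfi_x e (s e).
  rewrite rmorphM rmorph_prod rmorph_sum /=.
  under eq_bigr do rewrite psubst_var.
  under [X in _ * X]eq_bigr do rewrite psubst_var.
  by rewrite sum_vertex_axioms mulr1.
have E e : psubst (fun z => match z with inl x => pvar 'F_2 x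
                          | inr i => cfi u 1 i end)
    (y_ (y_edge e) *
     \prod_(e' | (enum_rank e' < enum_rank e)%N) (x_ e' 0 + x_ e' 1)) =
    (a e - 1) * \prod_(e' | (enum_rank e' < enum_rank e)%N) a e'.
  rewrite rmorphM rmorph_prod /= psubst_var; congr (_ * _).
  by apply: eq_bigr => e' _; rewrite rmorphD /= !psubst_var.
rewrite (eq_bigr _ (fun s _ => V s)) (eq_bigr _ (fun e _ => E e)).
rewrite telescope_prod.
(* Distributivity: a labelling chooses one summand from each factor [a e]. *)
have -> : \sum_(s : labelling) \prod_e cfi_x e (s e) = \prod_e a e.
  rewrite -(bigA_distr_bigA (fun e i => cfi_x e i)).
  apply: eq_bigr => e _; rewrite !big_ord_recl big_ord0 /= addr0.
  by congr (_ + cfi_x _ _); apply: val_inj.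
(* With [P = \prod_e a e], what remains is [P + (P - 1) = -1 = 1]. *)
have F2 := pchar2_mpolyF2 #|{: X}|.
by rewrite addrA (addrr_pchar2 F2) sub0r (oppr_pchar2 F2).
Qed.

(** * Symmetry under the CFI group *)

Definition act_axiom (p : labelling) (i : Y) : Y :=
  match i with
  | inl (inl (existT v r)) => inl (inl (existT _ v (r + restr v p)))
  | inl (inr e) => inl (inr e)
  | inr x => inr (cfi_act x p)
  end.

Definition act_var (p : labelling) (z : X + Y) : X + Y :=
  match z with
  | inl x => inl (cfi_act x p)
  | inr i => inr (act_axiom p i)
  end.

Definition act_gate (p : labelling) (g : ref_gate) : ref_gate :=
  match g with
  | inl (inl (inl z)) => g_in (act_var p z)
  | inl (inl (inr (inl s))) => g_vsum (s + p)
  | inl (inl (inr (inr s))) => g_vprod (s + p)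
  | inl (inr _) | inr _ => g
  end.

Lemma restrD v (s p : labelling) : restr v (s + p) = restr v s + restr v p.
Proof. by apply/ffunP=> e; rewrite !ffunE. Qed.

Lemma ffun_addKF2 (T : finType) (s p : {ffun T -> 'F_2}) : s + p + p = s.
Proof. by apply/ffunP=> e; rewrite !ffunE -addrA addrr_F2 addr0. Qed.

(** Since [p + p = 0], acting twice is the identity; this makes [act_gate p] a permutation of the
    gates. *)
Lemma act_gateK p : involutive (act_gate p).
Proof.
have xK x : cfi_act (cfi_act x p) p = x.
  by case: x => e i; rewrite /cfi_act /= -addrA addrr_F2 addr0.
move=> [[[[x|[[[v r]|e]|x]]|[s|s]]|[e|e]]|[]] //=; by rewrite ?xK ?ffun_addKF2.
Qed.

(** Wires into vertex gates test equalities whose two sides are shifted alike by [p]. Edges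
    themselves are fixed, so their enumeration order is respected. *)
Lemma act_gate_wire p g h :
  ref_wire (act_gate p g) (act_gate p h) = ref_wire g h.
Proof.
move: g h => [[[[x|[[[v r]|e]|x]]|[s|s]]|[e|e]]|[]]
  [[[[x'|[[[v' r']|e']|x']]|[s'|s']]|[e'|e']]|[]] //=.
- by rewrite ffunE (inj_eq (addIr _)).
- by rewrite restrD (inj_eq (addIr _)).
- by rewrite (inj_eq (addIr _)).
Qed.

Lemma act_axiom_cfi p i : p \in cfi_group G ->
  cfi u 1 (act_axiom p i) = rename_vars ((cfi_action G)^~ p) (cfi u 1 i).
Proof.
rewrite inE => /forallP pG; rewrite /rename_vars.
case: i => [[[v r]|e]|x] /=; last by rewrite rmorphB rmorphXn /= !psubst_var.
- rewrite /cfi_vertex_axiom rmorphB rmorph_sum /= psubst_const.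
  congr (_ - _%:MP).
    by apply: eq_bigr => e _; rewrite psubst_var !ffunE.
  under eq_bigr do rewrite !ffunE.
  (* Membership in the group makes the shifts at [v] sum to 0, which preserves the constant term. *)
  by rewrite big_split /= -(big_sub (incident v) p) (eqP (pG v)) addr0.
- rewrite rmorphB rmorphD rmorph1 /= !psubst_var /= /cfi_act /= add0r.
  have [->|->] : p e = 0 \/ p e = 1.
  - by case: (p e) => [[|[|//]]] lt; [left|right]; apply: val_inj.
  - by rewrite addr0.
  (* The shift swaps the two variables of the edge, leaving their sum unchanged. *)
  - by rewrite addrr_F2 [X in _ = X - 1]addrC.
Qed.

Lemma ref_circuit_symmetric :
  symmetric_circuit (cfi u 1) (cfi_action G) (cfi_group G) ref_circuit.
Proof.
move=> p pG; exists (act_var p).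
  by split=> // i; exists (act_axiom p i); rewrite ?act_axiom_cfi.
exists (perm (inv_inj (act_gateK p))); split=> [g h||g]; rewrite ?permE //.
  exact: act_gate_wire.
by move: g => [[[?|[?|?]]|[?|?]]|[]].
Qed.

(** With [m] edges and [3 * #|G| = 2 * m], the gates number [2 * 2 ^ m + 7 * m + 8 * #|G| + 1]. As
    [m < 2 ^ m], the factor 16 suffices. *)
Lemma ref_circuit_size :
  regular 3 G -> (ips_size ref_circuit <= 16 * 2 ^ #|edge G|)%N.
Proof.
move=> reg; have := regular_handshake reg; have := ltn_expl #|edge G| (ltnSn 1).
have cX : #|{: X}| = (#|edge G| * 2)%N by rewrite card_prod card_Fp.
have cY := card_cfi_index reg; rewrite !card_sum in cY.
rewrite /ips_size -[gate _]/ref_gate !card_sum cY cX card_ffun card_Fp //.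
by rewrite card_unit geq_max; lia.
Qed.

End Refutation.

Theorem theorem6p5
  (G : nat -> sgraph) (u : forall n : nat, vertex (G n))
  (Greg : forall n : nat, regular 3 (G n))
  (Gconn : forall n : nat, connected (G n)) :
  exists c : nat, forall n : nat,
  exists C : circuit 'F_2 (cfi_var (G n) + cfi_index (G n))%type,
    [/\ ips_refutation (cfi (u n) 1%R) C,
        y_linear C,
        symmetric_circuit (cfi (u n) 1%R) (cfi_action (G n))
          (cfi_group (G n)) C
      & (ips_size C <= c * 2 ^ #|edge (G n)|)%N].
Proof.
exists 16%N => n; exists (ref_circuit (u n)); split.
- exact: ref_circuit_refutation.
- exact: ref_circuit_y_linear.
- exact: ref_circuit_symmetric.
- exact: ref_circuit_size.
Qed.
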